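(* Let $f:\mathbb{R}^n\to\mathbb{R}$ be convex and $L$-smooth, $h:\mathbb{R}^n\to\mathbb{R}$ be convex and $L_h$-smooth, $F=f+h$, $0<\delta\le\frac14$, and assume that for the number of iterations $N\ge1$ the number $\hat\delta=2\sqrt{\frac{(L_h+2L)\delta}{(1-\sqrt{2\delta})^2L}}$ satisfies $\hat\delta\le\frac{C}{(N+1)^{3/2}}$ with some constant $C\in(0,1/4)$. Then for an arbitrary $\varepsilon>0$, after $$N=O\left(\sqrt{\frac{LR_0^2}{\varepsilon}}\right)$$ iterations of STM_IPS we have $F(x^N)-F(x^* )\le\varepsilon$. Moreover, $\delta$ should satisfy $$\delta=O\left(\frac{L}{(L_h+L)N^3}\right).$$
   Context: The problem is $\min_{x\in\mathbb{R}^n}F(x)$; $x^*$ is the minimizer of $F$ closest to the starting point $z^0=x^0$ (a minimizer is assumed to exist) and $R_0=\|x^*-z^0\|_2$. STM_IPS (Similar Triangles Method with Inexact Proximal Step): $\tilde x^0=z^0=x^0$, $\alpha_0=A_0=0$. For $k=0,\dots,N-1$: choose $\alpha_{k+1}>0$ with $A_k+\alpha_{k+1}=2L\alpha_{k+1}^2$, $A_{k+1}=A_k+\alpha_{k+1}$; $\tilde x^{k+1}=(A_kx^k+\alpha_{k+1}z^k)/A_{k+1}$; let $$g_{k+1}(z)=\frac12\|z^k-z\|_2^2+\alpha_{k+1}\left(f(\tilde x^{k+1})+\langle\nabla f(\tilde x^{k+1}),z-\tilde x^{k+1}\rangle+h(z)\right),\qquad\hat z^{k+1}=\mathrm{argmin}_{z\in\mathbb{R}^n}g_{k+1}(z),$$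 and let $z^{k+1}$ be any point with $g_{k+1}(z^{k+1})-g_{k+1}(\hat z^{k+1})\le\delta\|z^k-\hat z^{k+1}\|_2^2$; $x^{k+1}=(A_kx^k+\alpha_{k+1}z^{k+1})/A_{k+1}$. The constants in $O(\cdot)$ are absolute; the statement about $\delta$ says that the requirement $\hat\delta\le C/(N+1)^{3/2}$ forces $\delta$ to be of the indicated order. *)

(* Defs.v *)
From HB Require Import structures.
From mathcomp Require Import all_boot all_order all_algebra.
From mathcomp Require Import all_classical all_reals all_analysis.

Set Implicit Arguments.
Unset Strict Implicit.
Unset Printing Implicit Defensive.

Import Order.TTheory GRing.Theory Num.Theory.
Import numFieldNormedType.Exports.

Local Open Scope classical_set_scope.
Local Open Scope ring_scope.

Section Defs.
Context {R : realType} {n : nat}.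
Implicit Types (x y z : 'rV[R]_n) (f h : 'rV[R]_n -> R).

Definition dotp x y : R := \sum_(i < n) x 0 i * y 0 i.

(* The library norm [`|x|] on row vectors is the sup norm, hence this separate
   Euclidean norm. *)
Definition norm2 x : R := Num.sqrt (\sum_(i < n) x 0 i ^+ 2).

Definition gradient f x : 'rV[R]_n := \row_(i < n) 'D_(delta_mx 0 i) f x.

(* [differentiable] refers to the sup norm, which is equivalent to [norm2];
   the Lipschitz condition on the gradient is Euclidean. *)
Definition smooth f (L : R) : Prop :=
  (forall x, differentiable f x) /\
  (forall x y, norm2 (gradient f x - gradient f y) <= L * norm2 (x - y)).

Definition convex_on_space f : Prop :=
  @convex_function R 'rV[R]_n setT f.

Definition is_minimizer f x : Prop := forall y, f x <= f y.

Definition is_closest_minimizer f x0 x : Prop :=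
  is_minimizer f x /\
  forall y, is_minimizer f y -> norm2 (x - x0) <= norm2 (y - x0).

(* [prox_obj f h a u w] is the objective g_{k+1} of the proximal step, with
   a = alpha_{k+1}, u the point where f is linearized, and w = z^k. *)
Definition prox_obj f h (a : R) u w z : R :=
  2^-1 * norm2 (w - z) ^+ 2 +
  a * (f u + dotp (gradient f u) (z - u) + h z).

(* The sequences form a run of N iterations of the Similar Triangles Method
   with inexact proximal step; their values at indices above N are
   unconstrained. Since z^{k+1} may be any point satisfying the inexactness
   condition, a run is a relation and not a function of x0. *)
Record STM_IPS f h (L delta : R) (x0 : 'rV[R]_n) (N : nat)
    (alpha A : nat -> R) (xt x z zhat : nat -> 'rV[R]_n) : Prop := {
  stm_xt0 : xt 0%N = x0;
  stm_z0 : z 0%N = x0;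
  stm_x0 : x 0%N = x0;
  stm_alpha0 : alpha 0%N = 0;
  stm_A0 : A 0%N = 0;
  stm_alpha_gt0 : forall k, (k < N)%N -> 0 < alpha k.+1;
  stm_alphaS : forall k, (k < N)%N ->
    A k + alpha k.+1 = 2 * L * alpha k.+1 ^+ 2;
  stm_AS : forall k, (k < N)%N -> A k.+1 = A k + alpha k.+1;
  stm_xtS : forall k, (k < N)%N ->
    xt k.+1 = (A k.+1)^-1 *: (A k *: x k + alpha k.+1 *: z k);
  stm_zhatS : forall k, (k < N)%N ->
    is_minimizer (prox_obj f h (alpha k.+1) (xt k.+1) (z k)) (zhat k.+1);
  stm_zS : forall k, (k < N)%N ->
    prox_obj f h (alpha k.+1) (xt k.+1) (z k) (z k.+1) -
    prox_obj f h (alpha k.+1) (xt k.+1) (z k) (zhat k.+1)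
      <= delta * norm2 (z k - zhat k.+1) ^+ 2;
  stm_xS : forall k, (k < N)%N ->
    x k.+1 = (A k.+1)^-1 *: (A k *: x k + alpha k.+1 *: z k.+1)
}.

Definition delta_hat (L Lh delta : R) : R :=
  2 * Num.sqrt ((Lh + 2 * L) * delta /
                ((1 - Num.sqrt (2 * delta)) ^+ 2 * L)).

End Defs.

(* Main.v *)
Require Import Defs.
From HB Require Import structures.
From mathcomp Require Import all_boot all_order all_algebra.
From mathcomp Require Import all_classical all_reals all_analysis.
From mathcomp Require Import ring lra.

Set Implicit Arguments.
Unset Strict Implicit.
Unset Printing Implicit Defensive.

Import Order.TTheory GRing.Theory Num.Theory.
Import numFieldNormedType.Exports.

Local Open Scope ring_scope.

(** Why the theorem holds.  Write F = f + h, let xs be the given minimizer of F,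
    and consider the potential
      Phi_k = A_k * (F (x_k) - F xs) + 1/2 * norm2 (xs - z_k) ^+ 2.
    With exact proximal steps Phi_k is nonincreasing.  It is shown here that one
    inexact step with parameter delta costs only
      Phi_(k+1) <= Phi_k + 48 * delta * Phi_(k+1).
    As long as 48 * delta * N <= 1/2, a discrete Gronwall argument
    ([gronwall_half]) gives Phi_N <= 2 * Phi_0 = norm2 (xs - x0) ^+ 2.  Since
    A_N >= (N+1)^2 / (8 L) ([step_sum_ge]), the gap F (x_N) - F xs is at most
    8 L R0^2 / (N+1)^2 ([STM_IPS_gap]), and this is below eps as soon as
    N + 1 > 3 * sqrt (L R0^2 / eps).

    Two observations keep the analysis of one step elementary.

    - The inexactness is handled in terms of the exact proximal point zh alone.
      The proximal objective lies above its minimum by half the squared distance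
      to zh ([prox_min_le]).  Hence the inexact point z1 satisfies
      norm2 (z1 - zh) ^+ 2 <= 2 delta * norm2 (z - zh) ^+ 2, and replacing zh by
      z1 in the three-point inequality costs a small multiple of
      norm2 (z - z1) ^+ 2 plus a term of order delta * norm2 (xs - z1) ^+ 2
      ([inexact_prox_le]).  The first cost is paid by the negative term
      - 1/2 * norm2 (z - z1) ^+ 2 of the three-point inequality, the second one
      is the Gronwall term.

    - Because that negative term has to leave some slack, the descent inequality
      needs a constant smaller than L in front of norm2 v ^+ 2, but not the
      optimal L / 2.  The constant 3/4 L follows from two gradient
      inequalities, at x + v and at the midpoint x + v/2, without integration
      ([smooth_descent]).  In the step, 3/4 L becomes 3/8 because
      A_(k+1) = 2 L alpha_(k+1)^2, so that 1/8 remains for the inexactness.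

    The bound on delta_hat gives, after squaring,
    64 (Lh + 2 L) delta (N+1)^3 <= L ([delta_hat_bound]).  This is the stated order
    of delta, and it makes delta * N as small as the Gronwall argument asks. *)

(** * Euclidean geometry of row vectors *)

Section Euclid.
Context {R : realType} {n : nat}.
Implicit Types (x y z u v w : 'rV[R]_n) (f h : 'rV[R]_n -> R).

Lemma sqr_norm2 x : norm2 x ^+ 2 = dotp x x.
Proof.
by rewrite /norm2 sqr_sqrtr// sumr_ge0// => i _; exact: sqr_ge0.
Qed.

Lemma dotp_ge0 x : 0 <= dotp x x.
Proof. by rewrite -sqr_norm2 sqr_ge0. Qed.

Lemma dotpC x y : dotp x y = dotp y x.
Proof. by apply: eq_bigr => i _; rewrite mulrC. Qed.

Lemma dotpDl x y z : dotp (x + y) z = dotp x z + dotp y z.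
Proof. by rewrite -big_split; apply: eq_bigr => i _ /=; rewrite mxE mulrDl. Qed.

Lemma dotpZl (a : R) x y : dotp (a *: x) y = a * dotp x y.
Proof. by rewrite mulr_sumr; apply: eq_bigr => i _; rewrite mxE mulrA. Qed.

Lemma dotpNl x y : dotp (- x) y = - dotp x y.
Proof. by rewrite -scaleN1r dotpZl mulN1r. Qed.

Lemma dotpDr x y z : dotp z (x + y) = dotp z x + dotp z y.
Proof. by rewrite dotpC dotpDl !(dotpC z). Qed.

Lemma dotpZr (a : R) x y : dotp y (a *: x) = a * dotp y x.
Proof. by rewrite dotpC dotpZl (dotpC y). Qed.

Lemma dotpNr x y : dotp y (- x) = - dotp y x.
Proof. by rewrite dotpC dotpNl (dotpC y). Qed.

Definition dotpE := (dotpDl, dotpDr, dotpNl, dotpNr, dotpZl, dotpZr).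

Lemma sqr_norm2Z (a : R) x : norm2 (a *: x) ^+ 2 = a ^+ 2 * norm2 x ^+ 2.
Proof. by rewrite !sqr_norm2 !dotpE mulrA -expr2. Qed.

Lemma sqr_norm2_distC x y : norm2 (x - y) ^+ 2 = norm2 (y - x) ^+ 2.
Proof. by rewrite !sqr_norm2 -opprB dotpNl dotpNr opprK. Qed.

(** The weighted form of the Cauchy-Schwarz inequality: all estimates below are
    between squared norms, and the free weight c replaces square roots. *)
Lemma dotp_young (c : R) x y : 0 < c ->
  dotp x y <= c / 2 * norm2 x ^+ 2 + (2 * c)^-1 * norm2 y ^+ 2.
Proof.
move=> c0; have := dotp_ge0 (c *: x - y).
rewrite !sqr_norm2 !dotpE (dotpC y x) => H; rewrite -subr_ge0.
have -> : c / 2 * dotp x x + (2 * c)^-1 * dotp y y - dotp x y =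
  (2 * c)^-1 * (c * (c * dotp x x) - c * dotp x y - (c * dotp x y - dotp y y)).
  by field; rewrite gt_eqF.
by apply: mulr_ge0; [rewrite invr_ge0 mulr_ge0 ?ltW | lra].
Qed.

Lemma sqr_norm2D_le x y : norm2 (x + y) ^+ 2 <= 2 * norm2 x ^+ 2 + 2 * norm2 y ^+ 2.
Proof.
have := dotp_ge0 (x - y); rewrite !sqr_norm2 !dotpE (dotpC y x); lra.
Qed.

Lemma sqr_norm2_conv (t : R) x y :
  norm2 (t *: x + (1 - t) *: y) ^+ 2 =
  t * norm2 x ^+ 2 + (1 - t) * norm2 y ^+ 2 - t * (1 - t) * norm2 (x - y) ^+ 2.
Proof. by rewrite !sqr_norm2 !dotpE (dotpC y x); ring. Qed.

(** * Convex and smooth functions *)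

Lemma convex_on_spaceP f : convex_on_space f <->
  forall (t : R) x y, 0 <= t -> t <= 1 ->
    f (t *: x + (1 - t) *: y) <= t * f x + (1 - t) * f y.
Proof.
split=> [cf t x y t0 t1|cf t x y _ _].
  by have := cf (Itv01 t0 t1) x y; rewrite !in_setT => /(_ isT isT); rewrite convRE.
by rewrite convRE; apply: cf; [exact: ge0 | exact: le1].
Qed.

(** Differentiability makes the directional derivative linear in the direction,
    so the partial derivatives determine it. *)
Lemma dotp_gradient f x v : differentiable f x ->
  dotp (gradient f x) v = 'D_v f x.
Proof.
move=> df; rewrite [in RHS](row_sum_delta v) deriveE// linear_sum.
by apply: eq_bigr => i _; rewrite linearZ mxE deriveE//= mulrC.
Qed.

(** Convexity bounds the difference quotient of f at x in direction u - x, for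
    steps in (0, 1], by f u - f x; the bound passes to the limit. *)
Lemma convex_gradient_le f x u : convex_on_space f -> differentiable f x ->
  f x + dotp (gradient f x) (u - x) <= f u.
Proof.
move=> cf df; rewrite dotp_gradient// -lerBrDl.
have /cvg_dnbhs_at_right D := diff_derivable (v := u - x) df.
apply: (cvgr_to_le (a := 'D_(u - x) f x) D).
near=> t.
have t0 : 0 < t by near: t; exact: nbhs_right_gt.
have t1 : t <= 1 by near: t; exact: nbhs_right_le.
have := (convex_on_spaceP f).1 cf t u x (ltW t0) t1.
have -> : t *: u + (1 - t) *: x = t *: (u - x) + x.
  by rewrite scalerBr scalerBl scale1r addrCA addrC.
move=> H /=; rewrite /GRing.scale/= ler_pdivrMl//; lra.
Unshelve. all: by end_near. Qed.

(** The increment of f along v is split at the midpoint m of x and x + v.  On each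
    half, convexity bounds the increment by the gradient at the far end, and that
    gradient deviates from the one at x by at most L/2 * norm2 v at m and by
    L * norm2 v at x + v.  Averaging the two halves gives
    (1/2 + 1) / 2 = 3/4. *)
Lemma smooth_descent f (L : R) x v : 0 < L -> convex_on_space f -> smooth f L ->
  f (x + v) <= f x + dotp (gradient f x) v + 3 / 4 * L * norm2 v ^+ 2.
Proof.
move=> L0 cf [df lf].
pose g := gradient f; pose m := x + 2^-1 *: v.
have step y c : 0 < c ->  y - x = c *: v ->
    dotp (g y - g x) v <= c * L * norm2 v ^+ 2.
  move=> c0 yE; have cL : 0 < (c * L)^-1 by rewrite invr_gt0 mulr_gt0.
  have le_g : norm2 (g y - g x) ^+ 2 <= (c * L) ^+ 2 * norm2 v ^+ 2.
    rewrite [c * L]mulrC exprMn -mulrA -sqr_norm2Z -yE -exprMn.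
    by rewrite ler_sqr ?nnegrE ?lf// ?mulr_ge0 ?sqrtr_ge0// ltW.
  (* The weight 1 / (c L) balances the two terms of Young's inequality. *)
  have := dotp_young (g y - g x) v cL.
  have -> : (2 * (c * L)^-1)^-1 = c * L / 2 by field; rewrite !gt_eqF.
  have := ler_wpM2l (ltW cL) le_g.
  have -> : (c * L)^-1 * ((c * L) ^+ 2 * norm2 v ^+ 2) = c * L * norm2 v ^+ 2.
    by field; rewrite !gt_eqF.
  lra.
have sm : dotp (g m - g x) v <= 2^-1 * L * norm2 v ^+ 2.
  by apply: step; rewrite ?invr_gt0// /m addrC addKr.
have sy : dotp (g (x + v) - g x) v <= 1 * L * norm2 v ^+ 2.
  by apply: step; rewrite // scale1r addrC addKr.
have := convex_gradient_le x cf (df m); have := convex_gradient_le m cf (df (x + v)).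
have -> : x - m = - (2^-1 *: v) by rewrite /m opprD addNKr.
have -> : m - (x + v) = - (2^-1 *: v).
  rewrite /m opprD addrACA subrr add0r -[X in _ - X]scale1r -scalerBl -scaleNr.
  by congr (_ *: _); lra.
rewrite -/g in sm sy *; rewrite !dotpE in sm sy *; lra.
Qed.

(** * The inexact proximal step *)

(** The quadratic term makes the objective 1-strongly convex.  On the segment from
    zh to u, minimality of zh and strong convexity give, at parameter t, the
    inequality with the factor 1 - t in front of the squared distance; the claim
    is its limit as t tends to 0. *)
Lemma prox_min_le (phi : 'rV[R]_n -> R) w zh u : convex_on_space phi ->
  is_minimizer (fun z => 2^-1 * norm2 (w - z) ^+ 2 + phi z) zh ->
  2^-1 * norm2 (w - zh) ^+ 2 + phi zh + 2^-1 * norm2 (u - zh) ^+ 2 <=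
  2^-1 * norm2 (w - u) ^+ 2 + phi u.
Proof.
move=> cphi min_zh.
set G := 2^-1 * norm2 (w - zh) ^+ 2 + phi zh.
set H := 2^-1 * norm2 (w - u) ^+ 2 + phi u.
set q := norm2 (u - zh) ^+ 2.
have q0 : 0 <= q by exact: sqr_ge0.
have le_t t : 0 < t -> t <= 1 -> G + 2^-1 * (1 - t) * q <= H.
  move=> t0 t1; have := min_zh (t *: u + (1 - t) *: zh).
  have := (convex_on_spaceP phi).1 cphi t u zh (ltW t0) t1.
  have -> : w - (t *: u + (1 - t) *: zh) = t *: (w - u) + (1 - t) *: (w - zh).
    by apply/rowP => i; rewrite !mxE; ring.
  rewrite /= sqr_norm2_conv.
  have -> : w - u - (w - zh) = zh - u by apply/rowP => i; rewrite !mxE; ring.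
  rewrite (sqr_norm2_distC zh) -/q => le_phi le_G.
  by rewrite -(ler_pM2l t0) /H /G; lra.
(* The limit in t is taken by contradiction: if the claim fails by the amount e,
   then le_t at t = e / q makes e at most e / 2. *)
rewrite -/G leNgt; apply/negP => lt_HG.
have G0 : G <= H by have := le_t 1 ltr01 (lexx _); lra.
have qp : 0 < q by lra.
have t0 : 0 < (G + 2^-1 * q - H) / q by rewrite divr_gt0// subr_gt0.
have t1 : (G + 2^-1 * q - H) / q <= 1 by rewrite ler_pdivrMr// mul1r; lra.
have := le_t _ t0 t1.
have -> : 2^-1 * (1 - (G + 2^-1 * q - H) / q) * q =
  2^-1 * (q - (G + 2^-1 * q - H)) by field; rewrite gt_eqF.
lra.
Qed.

(** By [prox_min_le] at zn, the error of zn is a distance: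
    norm2 (zn - zh) ^+ 2 <= 2 delta * norm2 (w - zh) ^+ 2, which is at most
    6 delta * norm2 (w - zn) ^+ 2 for small delta.  In [prox_min_le] at u, zh is
    then exchanged for zn, and the cross term is split by Young's inequality with a
    weight proportional to delta, so that delta multiplies only the distance from
    u to zn. *)
Lemma inexact_prox_le (phi : 'rV[R]_n -> R) w zh zn u (delta : R) :
  convex_on_space phi -> 0 < delta -> delta <= 1 / 48 ->
  is_minimizer (fun z => 2^-1 * norm2 (w - z) ^+ 2 + phi z) zh ->
  2^-1 * norm2 (w - zn) ^+ 2 + phi zn -
    (2^-1 * norm2 (w - zh) ^+ 2 + phi zh) <= delta * norm2 (w - zh) ^+ 2 ->
  2^-1 * norm2 (w - zn) ^+ 2 + phi zn + 2^-1 * norm2 (u - zn) ^+ 2 <=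
  2^-1 * norm2 (w - u) ^+ 2 + phi u + 24 * delta * norm2 (u - zn) ^+ 2 +
  8^-1 * norm2 (w - zn) ^+ 2.
Proof.
move=> cphi d0 d1 min_zh err.
have near_zh := prox_min_le zn cphi min_zh.
have far_u := prox_min_le u cphi min_zh.
set p := norm2 (zn - zh) ^+ 2 in near_zh *.
set D := norm2 (w - zh) ^+ 2 in err near_zh far_u *.
set d := norm2 (w - zn) ^+ 2 in err near_zh *.
set r := norm2 (u - zn) ^+ 2.
have D_le : D <= 2 * d + 2 * p.
  rewrite /D (_ : w - zh = (w - zn) + (zn - zh)); first exact: sqr_norm2D_le.
  by rewrite addrA subrK.
have p_le : p <= 2 * (delta * D) by lra.
have D0 : 0 <= D by exact: sqr_ge0.
have p0 : 0 <= p by exact: sqr_ge0.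
have dD_le : delta * D <= D / 48 by have := ler_wpM2r D0 d1; lra.
have dD : delta * D <= 3 * (delta * d).
  by have := ler_wpM2l (ltW d0) (_ : D <= 3 * d); rewrite [_ * (3 * _)]mulrCA;
     apply; lra.
have d_ge0 : 0 <= d by exact: sqr_ge0.
have dd_le : delta * d <= d / 48 by have := ler_wpM2r d_ge0 d1; lra.
(* With weight 48 delta, the cross term costs 24 delta r + d / 16; the other
   d / 16 of the conclusion pays for delta * D. *)
have e0 : 0 < 48 * delta by rewrite mulr_gt0.
have := dotp_young (zn - u) (zn - zh) e0.
rewrite (sqr_norm2_distC zn u) -/r -/p.
have p_le' : (2 * (48 * delta))^-1 * p <= d / 16.
  rewrite ler_pdivrMl ?mulr_gt0//; lra.
have : norm2 (u - zh) ^+ 2 = r + p - 2 * dotp (zn - u) (zn - zh).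
  by rewrite /r /p !sqr_norm2 !dotpE (dotpC zn u) (dotpC zh u) (dotpC zh zn); ring.
move=> E; rewrite E in far_u; lra.
Qed.

End Euclid.

(** * One iteration *)

Section Run.
Context {R : realType}.

(** The similar triangles are the identities A1 * xt = A * x + a * z and
    x1 - xt = (a / A1) * (z1 - z).  By the first one, the model
    A1 * (f xt + <g, x1 - xt>) splits into A times the linearization at x, which
    convexity bounds by f x, and a times the linearization at z1, which the
    proximal step controls.  By the second one and A1 = 2 L a^2, the quadratic
    term of the descent inequality is 3/8 * norm2 (z - z1) ^+ 2; together with the
    1/8 from [inexact_prox_le] it cancels the 1/2 of the proximal objective. *)
Lemma similar_triangles_step n (f h : 'rV[R]_n -> R) (L delta a A A1 : R)
    (xs xt x z zh z1 x1 : 'rV[R]_n) :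
  0 < L -> convex_on_space f -> smooth f L -> convex_on_space h ->
  0 < delta -> delta <= 1 / 48 -> 0 <= A -> 0 < a ->
  A1 = 2 * L * a ^+ 2 -> A1 = A + a ->
  xt = A1^-1 *: (A *: x + a *: z) ->
  is_minimizer (prox_obj f h a xt z) zh ->
  prox_obj f h a xt z z1 - prox_obj f h a xt z zh <=
    delta * norm2 (z - zh) ^+ 2 ->
  x1 = A1^-1 *: (A *: x + a *: z1) ->
  A1 * (f x1 + h x1 - (f xs + h xs)) + 2^-1 * norm2 (xs - z1) ^+ 2 <=
  A * (f x + h x - (f xs + h xs)) + 2^-1 * norm2 (xs - z) ^+ 2 +
  24 * delta * norm2 (xs - z1) ^+ 2.
Proof.
move=> L0 cf sf ch d0 d1 A_ge0 a0 A1_quad A1E xtE min_zh err x1E.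
have A1_gt0 : 0 < A1 by lra.
have A1_neq0 : A1 != 0 by rewrite gt_eqF.
have df := sf.1.
pose g := gradient f xt.
pose phi y := a * (f xt + dotp g (y - xt) + h y).
have cphi : convex_on_space phi.
  apply/convex_on_spaceP => t u v t0 t1; rewrite /phi !dotpE.
  have := (convex_on_spaceP h).1 ch t u v t0 t1.
  by rewrite -(ler_pM2l a0); lra.
have prox := inexact_prox_le xs cphi d0 d1 min_zh err.
have xt_comb : A1 * dotp g xt = A * dotp g x + a * dotp g z.
  by rewrite xtE !dotpE; field.
pose v := (a / A1) *: (z1 - z).
have x1v : x1 = xt + v.
  by rewrite x1E xtE; apply/rowP => i; rewrite !mxE; field.
(* Multiplied by A1, the coefficient 3/4 L (a / A1)^2 becomes 3/8 since
   L a^2 = A1 / 2. *)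
have descent : A1 * f x1 <= A1 * f xt + a * dotp g (z1 - z) +
    3 / 8 * norm2 (z - z1) ^+ 2.
  have := smooth_descent xt v L0 cf sf.
  rewrite -x1v -(ler_pM2l A1_gt0) -/g /v sqr_norm2Z !dotpE (sqr_norm2_distC z1).
  have -> : A1 * (f xt + a / A1 * (dotp g z1 - dotp g z) +
      3 / 4 * L * ((a / A1) ^+ 2 * norm2 (z - z1) ^+ 2)) =
    A1 * f xt + a * (dotp g z1 - dotp g z) +
      3 / 8 * (2 * L * a ^+ 2) / A1 * norm2 (z - z1) ^+ 2 by field.
  by rewrite -A1_quad mulfK.
have x1_conv : A1 * h x1 <= A * h x + a * h z1.
  have t0 : 0 <= A / A1 by rewrite divr_ge0// ltW.
  have t1 : A / A1 <= 1 by rewrite ler_pdivrMr//; lra.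
  have := (convex_on_spaceP h).1 ch _ x z1 t0 t1.
  have tE : 1 - A / A1 = a / A1 by rewrite -(divff A1_neq0) -mulrBl A1E addrC addKr.
  rewrite tE -(ler_pM2l A1_gt0).
  have -> : A1 * (A / A1 * h x + a / A1 * h z1) = A * h x + a * h z1 by field.
  by rewrite x1E scalerDr !scalerA ![A1^-1 * _]mulrC.
have below_x := ler_wpM2l A_ge0 (convex_gradient_le x cf (df xt)).
have below_xs := ler_wpM2l (ltW a0) (convex_gradient_le xs cf (df xt)).
rewrite (sqr_norm2_distC xs z).
rewrite /phi -/g !dotpE in prox descent below_x below_xs.
rewrite A1E in descent x1_conv xt_comb *.
lra.
Qed.

(** * Accumulation over the run *)

(** By induction (1 - k e) Phi_k <= Phi_0, because (1 - k e) (1 - e) is at least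
    1 - (k+1) e; and 1 - N e >= 1/2. *)
Lemma gronwall_half (Phi : nat -> R) (e : R) N :
  0 <= e -> N%:R * e <= 1 / 2 ->
  (forall k, (k < N)%N -> 0 <= Phi k.+1) ->
  (forall k, (k < N)%N -> Phi k.+1 <= Phi k + e * Phi k.+1) ->
  0 <= Phi 0%N -> Phi N <= 2 * Phi 0%N.
Proof.
move=> e0 Ne Phi_ge0 Phi_step Phi0.
have [->|N0] := posnP N; first lra.
have main k : (k <= N)%N -> (1 - k%:R * e) * Phi k <= Phi 0%N.
  elim: k => [_|k IH kN]; first by rewrite mul0r subr0 mul1r.
  have ke : k%:R * e <= 1 / 2.
    by apply: le_trans Ne; rewrite ler_wpM2r// ler_nat ltnW.
  have ke0 : 0 <= 1 - k%:R * e by lra.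
  have := ler_wpM2l ke0 (Phi_step _ kN); have := IH (ltnW kN).
  have : 0 <= k%:R * e * e * Phi k.+1 by rewrite !mulr_ge0 ?Phi_ge0.
  rewrite -natr1; lra.
have := main N (leqnn N).
have PhiN : 0 <= Phi N by rewrite -(prednK N0) Phi_ge0// prednK.
have : N%:R * e * Phi N <= 1 / 2 * Phi N by rewrite ler_wpM2r.
lra.
Qed.

(** In terms of the rescaled steps beta = 4 L alpha, two consecutive defining
    equations read beta'^2 - 2 beta' = beta^2, i.e. (beta' - 1)^2 = beta^2 + 1, so
    beta grows by more than 1 in each iteration; it starts at 2.  Finally
    8 L A = beta^2. *)
Lemma step_sum_ge (L : R) (alpha A : nat -> R) N : 0 < L -> A 0%N = 0 ->
  (forall k, (k < N)%N -> 0 < alpha k.+1) ->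
  (forall k, (k < N)%N -> A k + alpha k.+1 = 2 * L * alpha k.+1 ^+ 2) ->
  (forall k, (k < N)%N -> A k.+1 = A k + alpha k.+1) ->
  forall k, (k < N)%N -> k.+2%:R ^+ 2 <= 8 * L * A k.+1.
Proof.
move=> L0 A0 alpha_gt0 alphaS AS.
have beta_ge k : (k < N)%N -> k.+2%:R <= 4 * L * alpha k.+1.
  elim: k => [kN|k IH kN].
    by have := alphaS _ kN; rewrite A0 -(ler_pM2r (alpha_gt0 _ kN)); lra.
  have kN' := ltnW kN; have {}IH := IH kN'.
  have a0 := alpha_gt0 _ kN; have a0' := alpha_gt0 _ kN'.
  have : 2 * L * alpha k.+1 ^+ 2 + alpha k.+2 = 2 * L * alpha k.+2 ^+ 2.
    by rewrite -(alphaS _ kN) (AS _ kN') (alphaS _ kN').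
  set b := 4 * L * alpha k.+1 in IH; set c := 4 * L * alpha k.+2 => E.
  have {}E : c ^+ 2 - 2 * c = b ^+ 2.
    apply/eqP; rewrite -subr_eq0 /c /b.
    have -> : (4 * L * alpha k.+2) ^+ 2 - 2 * (4 * L * alpha k.+2) -
      (4 * L * alpha k.+1) ^+ 2 = 8 * L * (2 * L * alpha k.+2 ^+ 2 -
      (2 * L * alpha k.+1 ^+ 2 + alpha k.+2)) by ring.
    by rewrite E subrr mulr0.
  have c0 : 0 < c by rewrite !mulr_gt0.
  have k0 : 0 <= k%:R :> R by exact: ler0n.
  have -> : k.+3%:R = k.+2%:R + 1 :> R by rewrite natr1.
  suff : b + 1 <= c by lra.
  have b0 : 0 < b by rewrite !mulr_gt0.
  rewrite leNgt; apply/negP => cb; nra.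
move=> k kN; have := beta_ge _ kN; rewrite (AS _ kN) (alphaS _ kN) => b.
have -> : 8 * L * (2 * L * alpha k.+1 ^+ 2) = (4 * L * alpha k.+1) ^+ 2 by ring.
by rewrite ler_sqr// nnegrE ?(le_trans _ b).
Qed.

(** * The order of delta *)

Lemma powR_three_halves_sqr (x : R) : 0 <= x -> (x `^ (3 / 2)) ^+ 2 = x ^+ 3.
Proof.
by move=> x0; rewrite -powR_mulrn ?powR_ge0// -powRrM divfK// powR_mulrn.
Qed.

(** The square of the bound on delta_hat reads
    4 (Lh + 2 L) delta (N+1)^3 <= C^2 (1 - sqrt (2 delta))^2 L, where C^2 <= 1/16
    and (1 - sqrt (2 delta))^2 <= 1. *)
Lemma delta_hat_bound (L Lh delta C : R) (N : nat) :
  0 < L -> 0 <= Lh -> 0 < delta -> delta <= 1 / 4 -> 0 < C -> C < 1 / 4 ->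
  delta_hat L Lh delta <= C / N.+1%:R `^ (3 / 2) ->
  64 * (Lh + 2 * L) * delta * N.+1%:R ^+ 3 <= L.
Proof.
move=> L0 Lh0 d0 d1 C0 C1.
set s := Num.sqrt (2 * delta).
have s0 : 0 <= s by exact: sqrtr_ge0.
have s2 : s ^+ 2 = 2 * delta by rewrite sqr_sqrtr//; lra.
have s1 : s < 1 by rewrite ltNge; apply/negP => ?; nra.
have M0 : 0 < N.+1%:R :> R by rewrite ltr0n.
set P := N.+1%:R `^ (3 / 2).
have P0 : 0 < P by exact: powR_gt0.
have P2 : P ^+ 2 = N.+1%:R ^+ 3 by rewrite powR_three_halves_sqr// ltW.
have q0 : 0 < (1 - s) ^+ 2 by rewrite exprn_gt0// subr_gt0.
have q1 : (1 - s) ^+ 2 <= 1 by rewrite expr_le1//; lra.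
rewrite /delta_hat -/s => le_C.
have rad_ge0 : 0 <= (Lh + 2 * L) * delta / ((1 - s) ^+ 2 * L).
  by rewrite divr_ge0 ?mulr_ge0 ?ltW//; lra.
have dh0 : 0 <= 2 * Num.sqrt ((Lh + 2 * L) * delta / ((1 - s) ^+ 2 * L)).
  by rewrite mulr_ge0 ?sqrtr_ge0.
have CP0 : 0 <= C / P by rewrite divr_ge0 ?ltW.
move: le_C; rewrite -ler_sqr ?nnegrE// exprMn sqr_sqrtr//.
rewrite mulrA ler_pdivrMr ?(mulr_gt0 q0)// expr_div_n P2.
rewrite [C ^+ 2 / _ * _]mulrAC ler_pdivlMr ?exprn_gt0// => H.
have C2 : C ^+ 2 <= 1 / 16 by nra.
have : C ^+ 2 * ((1 - s) ^+ 2 * L) <= 1 / 16 * (1 * L).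
  apply: ler_pM => //; [exact: sqr_ge0 | by rewrite ltW// mulr_gt0 |].
  by rewrite ler_pM2r.
move: H; set T := N.+1%:R ^+ 3; lra.
Qed.

End Run.

(** * The convergence rate *)

(** [Phi] below is the potential of the similar triangles method.  Its value at 0
    is R0^2 / 2 since A 0 = 0, and the Gronwall factor 2 makes the bound at N equal
    to R0^2; dropping the distance term leaves A N times the gap. *)
Lemma STM_IPS_gap (R : realType) n (f h : 'rV[R]_n -> R) (L delta : R)
    (x0 xs : 'rV[R]_n) (N : nat) alpha A xt x z zhat :
  0 < L -> convex_on_space f -> smooth f L -> convex_on_space h ->
  is_minimizer (fun y => f y + h y) xs ->
  0 < delta -> delta <= 1 / 48 -> N%:R * (48 * delta) <= 1 / 2 ->
  (1 <= N)%N ->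
  STM_IPS f h L delta x0 N alpha A xt x z zhat ->
  N.+1%:R ^+ 2 * (f (x N) + h (x N) - (f xs + h xs)) <=
  8 * (L * norm2 (xs - x0) ^+ 2).
Proof.
move=> L0 cf sf ch min_xs d0 d1 Nd N1 run.
have gap_ge0 y : 0 <= f y + h y - (f xs + h xs) by rewrite subr_ge0.
have A_ge0 k : (k <= N)%N -> 0 <= A k.
  elim: k => [_|k IH kN]; first by rewrite (stm_A0 run).
  rewrite (stm_AS run kN) addr_ge0 ?IH 1?ltnW//.
  exact: ltW (stm_alpha_gt0 run kN).
pose Phi k := A k * (f (x k) + h (x k) - (f xs + h xs)) +
  2^-1 * norm2 (xs - z k) ^+ 2.
have Phi0E : Phi 0%N = 2^-1 * norm2 (xs - x0) ^+ 2.
  by rewrite /Phi (stm_A0 run) (stm_z0 run) mul0r add0r.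
have Phi_ge0 k : (k < N)%N -> 0 <= Phi k.+1.
  move=> kN; apply: addr_ge0; apply: mulr_ge0; rewrite ?invr_ge0 ?sqr_ge0//.
  exact: A_ge0.
have Phi_step k : (k < N)%N -> Phi k.+1 <= Phi k + 48 * delta * Phi k.+1.
  move=> kN; have AS := stm_AS run kN.
  have A_quad : A k.+1 = 2 * L * alpha k.+1 ^+ 2.
    by rewrite AS (stm_alphaS run kN).
  have step := similar_triangles_step xs L0 cf sf ch d0 d1 (A_ge0 _ (ltnW kN))
    (stm_alpha_gt0 run kN) A_quad AS (stm_xtS run kN) (stm_zhatS run kN)
    (stm_zS run kN) (stm_xS run kN).
  apply: le_trans step _; rewrite lerD2l.
  have : 0 <= 48 * delta * (A k.+1 * (f (x k.+1) + h (x k.+1) - (f xs + h xs))).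
    by rewrite !mulr_ge0 ?A_ge0 ?gap_ge0// ltW.
  rewrite /Phi; lra.
have e0 : 0 <= 48 * delta by rewrite mulr_ge0// ltW.
have Phi_le : Phi N <= norm2 (xs - x0) ^+ 2.
  have Phi0 : 0 <= Phi 0%N by rewrite Phi0E mulr_ge0 ?invr_ge0 ?sqr_ge0.
  by have := gronwall_half e0 Nd Phi_ge0 Phi_step Phi0; rewrite Phi0E; lra.
have AN : N.+1%:R ^+ 2 <= 8 * L * A N.
  have := step_sum_ge L0 (stm_A0 run)
    (stm_alpha_gt0 run) (stm_alphaS run)
    (stm_AS run).
  by move=> /(_ N.-1); rewrite prednK// => /(_ (leqnn _)).
apply: le_trans (ler_wpM2r (gap_ge0 _) AN) _.
rewrite -!mulrA !ler_pM2l//; apply: le_trans Phi_le.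
by rewrite lerDl mulr_ge0 ?sqr_ge0.
Qed.

Theorem corollaryE5 (R : realType) :
  exists c1 c2 : R, 0 < c1 /\ 0 < c2 /\
  forall (n : nat) (f h : 'rV[R]_n -> R) (L Lh : R) (x0 xstar : 'rV[R]_n),
    0 < L -> 0 <= Lh ->
    convex_on_space f -> smooth f L ->
    convex_on_space h -> smooth h Lh ->
    is_closest_minimizer (fun y => f y + h y) x0 xstar ->
    forall eps : R, 0 < eps ->
    exists Neps : nat,
      Neps%:R <= c1 * Num.sqrt (L * norm2 (xstar - x0) ^+ 2 / eps) /\
      forall (N : nat) (delta C : R),
        (1 <= N)%N ->
        0 < delta -> delta <= 1 / 4 ->
        0 < C -> C < 1 / 4 ->
        delta_hat L Lh delta <= C / (N.+1)%:R `^ (3 / 2) ->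
        ((Neps <= N)%N ->
         forall (alpha A : nat -> R) (xt x z zhat : nat -> 'rV[R]_n),
           STM_IPS f h L delta x0 N alpha A xt x z zhat ->
           (f (x N) + h (x N)) - (f xstar + h xstar) <= eps) /\
        delta <= c2 * (L / ((Lh + L) * N%:R ^+ 3)).
Proof.
(* 3 works as 3^2 >= 8, the constant of the rate.  With the integer part of
   3 q as threshold, N >= Neps gives N + 1 > 3 q, also when Neps = 0. *)
exists 3, 1; do 2!split => //.
move=> n f h L Lh x0 xs L0 Lh0 cf sf ch _ [min_xs _] eps eps0.
set r := norm2 (xs - x0) ^+ 2.
set q := Num.sqrt (L * r / eps).
have r0 : 0 <= r by exact: sqr_ge0.
have L_ge0 := ltW L0; have Lr0 : 0 <= L * r / eps.
  exact: divr_ge0 (mulr_ge0 L_ge0 r0) (ltW eps0).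
have q0 : 0 <= 3 * q by rewrite mulr_ge0 ?sqrtr_ge0.
exists (Num.truncn (3 * q)); split; first by rewrite truncn_le.
move=> N delta C N1 d0 d1 C0 C1 dh_le.
have := delta_hat_bound L0 Lh0 d0 d1 C0 C1 dh_le.
set M := N.+1%:R => d_le.
have d_ge0 := ltW d0; have M3_ge0 : 0 <= M ^+ 3 by rewrite exprn_ge0// ler0n.
have N1R : 1 <= N%:R :> R by rewrite ler1n.
have ME : M = N%:R + 1 by rewrite /M natr1.
have M_ge2 : 2 <= M by rewrite ME; lra.
have M3 : 4 * M <= M ^+ 3.
  by rewrite exprSr ler_wpM2r ?ler0n//; have := sqr_ge0 (M - 2); lra.
have d_small : 512 * (delta * M) <= 1.
  have : 128 * L * (delta * (4 * M)) <= 128 * L * (delta * M ^+ 3).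
    by rewrite ler_pM2l ?mulr_gt0// ler_pM2l.
  have : 0 <= 64 * Lh * delta * M ^+ 3.
    by rewrite !mulr_ge0.
  rewrite -[512 * _ <= 1](ler_pM2l L0); lra.
split.
  move=> NepsN alpha A xt x z zhat run.
  have gap := STM_IPS_gap L0 cf sf ch min_xs d0 _ _ N1 run.
  have {}gap : M ^+ 2 * (f (x N) + h (x N) - (f xs + h xs)) <= 8 * (L * r).
    have := ler_wpM2l d_ge0 M_ge2; rewrite ME in d_small; rewrite {1}ME => dM.
    by apply: gap; lra.
  have qM : 3 * q < M.
    have /andP[_] := truncn_itv q0; move=> /lt_le_trans; apply.
    by rewrite ler_nat.
  have : 9 * (L * r) <= eps * M ^+ 2.
    have : (3 * q) ^+ 2 <= M ^+ 2 by rewrite ler_sqr ?nnegrE ?ler0n// ltW.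
    rewrite exprMn sqr_sqrtr// [3 ^+ 2 * (_ / _)]mulrA ler_pdivrMr//; lra.
  move=> Lr_le; have M2 : 0 < M ^+ 2 by rewrite exprn_gt0 ?ltr0n.
  rewrite -(ler_pM2l M2).
  have : 0 <= L * r by rewrite mulr_ge0.
  lra.
have N3 : 0 < N%:R ^+ 3 :> R by rewrite exprn_gt0// ltr0n.
have NM : N%:R ^+ 3 <= M ^+ 3 by rewrite lerXn2r ?nnegrE ?ler0n// ler_nat.
have LhL : 0 < Lh + L by lra.
rewrite mul1r ler_pdivlMr ?(mulr_gt0 LhL)//.
have : delta * (Lh + L) * N%:R ^+ 3 <= delta * (Lh + L) * M ^+ 3.
  by rewrite ler_wpM2l// mulr_ge0 ?addr_ge0.
have : 0 <= delta * L * M ^+ 3 by rewrite !mulr_ge0.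
have : 0 <= delta * Lh * M ^+ 3 by rewrite !mulr_ge0.
lra.
Qed.
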